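(* Let $X$ and $Z$ be pre-Riesz spaces and let $(Y,i)$ be a vector lattice cover of $Z$. Let $T\colon X\to Z$ be a positive linear operator such that $i\circ T\in L_{oc}(X,Y)$. Then $T\in L_{oc}(X,Z)$.
   Context: All vector spaces are real. An ordered vector space is a real vector space $X$ with a cone $X_+$ (closed under nonnegative linear combinations, with $X_+\cap(-X_+)=\{0\}$), ordered by $x\le y$ iff $y-x\in X_+$. A linear operator $T\colon X\to Z$ is positive if $T(X_+)\subseteq Z_+$. A linear map $i\colon X\to Y$ between ordered vector spaces is bipositive if for every $x\in X$: $i(x)\ge 0$ iff $x\ge 0$. A linear subspace $D$ of an ordered vector space $Y$ is order dense in $Y$ if for every $y\in Y$ the infimum of $\{z\in D : y\le z\}$ exists in $Y$ and equals $y$. An ordered vector space $Z$ is a pre-Riesz space if there exist a vector lattice $Y$ and a bipositive linear map $i\colon Z\to Y$ such that $i(Z)$ is order dense in $Y$; then $(Y,i)$ is called a vector lattice cover of $Z$. For a net, $z_\alpha\downarrow 0$ means that $\alpha\le\beta$ implies $z_\alpha\ge z_\beta$ and $\inf_\alpha z_\alpha=0$. A net $(x_\alpha)_\alpha$ in $X$ order converges to $x\in X$ if there is a net $(z_\alpha)_\alpha$ in $X$ (with the same index set) such that $z_\alpha\downarrow 0$ and $\pm(x-x_\alpha)\le z_\alpha$ for every $\alpha$. A linear operator $T\colon X\to Z$ is order continuous if for every net $(x_\alpha)_\alpha$ in $X$ that order converges to some $x\in X$, the net $(T(x_\alpha))_\alpha$ order converges to $T(x)$ in $Z$. $L_{oc}(X,Z)$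 denotes the set of all order continuous linear operators from $X$ to $Z$. *)

(* Defs.v *)
From HB Require Import structures.
From mathcomp Require Export all_boot all_order all_algebra.
From mathcomp Require Export boolp classical_sets reals.

Set Implicit Arguments.
Unset Strict Implicit.
Unset Printing Implicit Defensive.

Import Order.TTheory GRing.Theory Num.Theory.

Local Open Scope classical_set_scope.
Local Open Scope ring_scope.

(* The cone is [set x | 0 <= x]; its pointedness, X_+ :&: (- X_+) = {0}, is
   the antisymmetry of the order. *)
HB.mixin Record POrderedZmodule_isOrderedVector (R : realType) X
    of GRing.Lmodule R X & Num.POrderedZmodule X := {
  le_subr_ge0 : forall x y : X, (x <= y) = (0 <= y - x);
  cone_comb_ge0 : forall (a b : R) (x y : X),
    0 <= a -> 0 <= b -> 0 <= x -> 0 <= y -> 0 <= a *: x + b *: y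
}.

#[short(type="orderedVectType")]
HB.structure Definition OrderedVector (R : realType) :=
  {X of GRing.Lmodule R X & Num.POrderedZmodule X &
        POrderedZmodule_isOrderedVector R X}.

Section Maps.
Variable R : realType.

Definition positive_operator (X Z : orderedVectType R) (T : X -> Z) : Prop :=
  forall x, 0 <= x -> 0 <= T x.

Definition bipositive (X Y : orderedVectType R) (i : X -> Y) : Prop :=
  forall x, 0 <= i x <-> 0 <= x.

(* [supremums A] and [infimums A] are the sets of least upper bounds and of
   greatest lower bounds of [A]; each has at most one element. *)
Definition vector_lattice (Y : orderedVectType R) : Prop :=
  forall x y : Y, supremums [set x; y] !=set0 /\ infimums [set x; y] !=set0.

Definition order_dense (Y : orderedVectType R) (D : set Y) : Prop :=
  forall y, infimums [set z | D z /\ y <= z] y.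

Definition vector_lattice_cover (Z : orderedVectType R)
    (Y : orderedVectType R) (i : {linear Z -> Y}) : Prop :=
  [/\ vector_lattice Y, bipositive i & order_dense (range i)].

Definition pre_Riesz (Z : orderedVectType R) : Prop :=
  exists (Y : orderedVectType R) (i : {linear Z -> Y}),
    vector_lattice_cover i.

End Maps.

Record directed (A : Type) (leA : A -> A -> Prop) : Prop := Directed {
  directed_inh : inhabited A;
  directed_refl : forall a, leA a a;
  directed_trans : forall a b c, leA a b -> leA b c -> leA a c;
  directed_ub : forall a b, exists c, leA a c /\ leA b c
}.

Section OrderContinuity.
Variable R : realType.

Definition decreases_to_0 (A : Type) (leA : A -> A -> Prop)
    (X : orderedVectType R) (z_ : A -> X) : Prop :=
  (forall a b, leA a b -> z_ b <= z_ a) /\ infimums (range z_) 0.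

Definition order_converges (A : Type) (leA : A -> A -> Prop)
    (X : orderedVectType R) (x_ : A -> X) (x : X) : Prop :=
  exists z_ : A -> X, decreases_to_0 leA z_ /\
    forall a, x - x_ a <= z_ a /\ - (x - x_ a) <= z_ a.

Definition order_continuous (X Z : orderedVectType R) (T : X -> Z) : Prop :=
  forall (A : Type) (leA : A -> A -> Prop), directed leA ->
  forall (x_ : A -> X) (x : X),
    order_converges leA x_ x -> order_converges leA (fun a => T (x_ a)) (T x).

Definition L_oc (X Z : orderedVectType R) : set {linear X -> Z} :=
  [set T | order_continuous T].

End OrderContinuity.

(* Main.v *)
(** If [z_ a] decreases to 0 and dominates [x - x_ a], then [T (z_ a)] is
    decreasing and dominates [T x - T (x_ a)], so only [inf T (z_ a) = 0] in [Z]
    is at stake. As [z_ a] itself order converges to 0, some net [w_ a]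
    decreasing to 0 in [Y] dominates [i (T (z_ a))]; a lower bound [v] of
    [T (z_ a)] then satisfies [i v <= w_ a] for all [a], hence [i v <= 0], and
    [v <= 0] because [i] is bipositive. *)
Require Import Defs.
Import Order.TTheory GRing.Theory Num.Theory.
Local Open Scope classical_set_scope.
Local Open Scope ring_scope.

Section OrderedVectorSpaces.
Set Implicit Arguments.
Unset Strict Implicit.
Variable R : realType.

Lemma oppv_le0 (X : orderedVectType R) (x : X) : (- x <= 0) = (0 <= x).
Proof. by rewrite le_subr_ge0 sub0r opprK. Qed.

Lemma positive_operator_le (X Z : orderedVectType R) (T : {linear X -> Z}) :
  positive_operator T -> {homo T : x y / x <= y}.
Proof.
by move=> hT x y; rewrite [x <= y]le_subr_ge0 [T x <= T y]le_subr_ge0 -linearB => /hT.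
Qed.

Lemma bipositive_le (X Y : orderedVectType R) (i : {linear X -> Y}) x y :
  bipositive i -> i x <= i y <-> x <= y.
Proof.
by move=> hi; rewrite [i x <= _]le_subr_ge0 [x <= _]le_subr_ge0 -linearB; exact: hi.
Qed.

Lemma infimums_range0P (A : Type) (X : orderedVectType R) (z_ : A -> X) :
  infimums (range z_) 0 <->
  (forall a, 0 <= z_ a) /\ (forall v, (forall a, v <= z_ a) -> v <= 0).
Proof.
split=> [[lb glb]|[lb glb]]; split.
- by move=> a; apply: lb; exists a.
- by move=> v hv; apply: glb => _ [a _ <-].
- by move=> _ [a _ <-].
- by move=> v hv; apply: glb => a; apply: hv; exists a.
Qed.

(** The net [z_] is its own dominating net, since [- z_ a <= 0 <= z_ a]. *)
Lemma decreases_to_0_order_converges (A : Type) (leA : A -> A -> Prop)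
    (X : orderedVectType R) (z_ : A -> X) :
  decreases_to_0 leA z_ -> order_converges leA z_ 0.
Proof.
move=> hz; exists z_; split=> // a.
have [ge0 _] := (infimums_range0P z_).1 hz.2.
rewrite sub0r opprK; split=> //.
by apply: (@le_trans _ _ 0) => //; rewrite oppv_le0.
Qed.

End OrderedVectorSpaces.

Theorem theorem16 (R : realType) (X Z : orderedVectType R)
    (hX : pre_Riesz X) (hZ : pre_Riesz Z)
    (Y : orderedVectType R) (i : {linear Z -> Y})
    (hi : vector_lattice_cover i)
    (T : {linear X -> Z}) (hT : positive_operator T)
    (hiT : @L_oc R X Y (i \o T)) :
  @L_oc R X Z T.
Proof.
have [_ ibip _] := hi.
move=> A leA dirA x_ x [z_ [hz dom]].
have [ge0 _] := (infimums_range0P z_).1 hz.2.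
exists (fun a => T (z_ a)); split; last first.
  (* By linearity both bounds compare values of [T], so monotonicity carries over those for
     [x - x_ a]. *)
  by move=> a; have [h1 h2] := dom a; rewrite -linearB -linearN;
    split; apply: positive_operator_le.
split; first by move=> a b /hz.1; exact: positive_operator_le.
apply/infimums_range0P; split=> [a|v hv]; first exact: hT.
have [w_ [[_ winf] wdom]] :=
  hiT _ _ dirA _ _ (decreases_to_0_order_converges hz).
have [_ wglb] := (infimums_range0P w_).1 winf.
apply/(bipositive_le _ _ ibip); rewrite linear0; apply: wglb => a.
(* As the limit is 0, the second half of [wdom a] reads [i (T (z_ a)) <= w_ a]; what remains is
   [i v <= i (T (z_ a))]. *)
have [_] := wdom a; rewrite /= !linear0 sub0r opprK; apply: le_trans.
exact/(bipositive_le _ _ ibip).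
Qed.
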